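(* There is an absolute constant $C>0$ such that the following holds. Let $y\ge1$, let $P\subset\mathcal{P}\cap[1,y]$ be nonempty, and for each $p\in P$ let $f_p\colon\mathbb{Z}\to\mathbb{C}$ and $g\colon\mathbb{Z}\to\mathbb{C}$ be functions bounded in modulus by $1$. Then for every integer $N\ge2$, $$\Big|\mathbb{E}^{\log}_{p\in P}\mathbb{E}^{\log}_{n\in[N]}f_p(n)g(pn)\Big|^2\le\mathrm{Re}\Big(\mathbb{E}^{\log}_{p,q\in P}\mathbb{E}^{\log}_{n\in[N]}f_p(qn)\overline{f_q(pn)}\Big)+C\Big(\Big(\sum_{p\in P}\frac1p\Big)^{-1}+\frac{\log y}{\log N}\Big).$$
   Context: $\mathcal{P}$ is the set of primes, $[N]=\{1,\dots,N\}$. For finite nonempty $B\subset\mathbb{N}$, $\mathbb{E}^{\log}_{n\in B}f(n)=\big(\sum_{n\in B}f(n)/n\big)/\big(\sum_{n\in B}1/n\big)$, and $\mathbb{E}^{\log}_{p,q\in P}$ denotes the logarithmic average over pairs, i.e. $\mathbb{E}^{\log}_{p\in P}\mathbb{E}^{\log}_{q\in P}$. *)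

(* Defs.v *)
From mathcomp Require Import all_boot all_order all_algebra finmap.
From mathcomp Require Import complex.

Set Implicit Arguments.
Unset Strict Implicit.
Unset Printing Implicit Defensive.

Import Order.TTheory GRing.Theory Num.Theory.
Local Open Scope fset_scope.
Local Open Scope ring_scope.
Local Open Scope complex_scope.

Definition initial (N : nat) : {fset nat} := [fset n in iota 1 N].

(* Meant for nonempty B not containing 0: the library sets 0^-1 = 0. *)
Definition log_avg (R : rcfType) (B : {fset nat}) (f : nat -> R[i]) : R[i] :=
  (\sum_(n <- B) f n / n%:R) / (\sum_(n <- B) n%:R^-1).

Definition log_avg2 (R : rcfType) (B : {fset nat})
    (f : nat -> nat -> R[i]) : R[i] :=
  log_avg B (fun p => log_avg B (fun q => f p q)).

(* Main.v *)
(* The weights 1/n are dilation invariant, so the substitution m = p n turns the average into a sum over m <= N of g(m)/m times the sum of f_p(m/p) over the p in P dividing m; only the range N < m <= p N is lost, at cost O(log y / log N). Cauchy-Schwarz in m removes g, and opening the square gives pairs (p, q): off the diagonal m = p q n, which is the dilated correlation of f_p and f_q up to another O(log y / log N), while the diagonal contributes at most the inverse of the sum of 1/p. *)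
Require Import Defs.
From mathcomp Require Import all_boot all_order all_algebra finmap.
From mathcomp Require Import reals exp.
From mathcomp Require Import complex.
From mathcomp Require Import lra ring zify.

Import Order.TTheory GRing.Theory Num.Theory.
Local Open Scope fset_scope.
Local Open Scope ring_scope.
Local Open Scope complex_scope.

(** * Modulus and real part of complex sums and of real rescalings *)

Lemma normc_sum (R : rcfType) (I : Type) (r : seq I) (Q : pred I)
    (F : I -> R[i]) :
  Normc.normc (\sum_(i <- r | Q i) F i)
    <= \sum_(i <- r | Q i) Normc.normc (F i).
Proof.
elim/big_ind2: _ => [|x a y b xa yb|//]; first by rewrite Normc.normc0.
exact: le_trans (le_normcD _ _) (lerD xa yb).
Qed.

Lemma Re_sum (R : rcfType) (I : Type) (r : seq I) (Q : pred I)
    (F : I -> R[i]) :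
  complex.Re (\sum_(i <- r | Q i) F i) = \sum_(i <- r | Q i) complex.Re (F i).
Proof. by apply: (big_morph (@complex.Re R)) => // -[a b] [c d]. Qed.

Lemma normc_ge0 (R : rcfType) (z : R[i]) : 0 <= Normc.normc z.
Proof. by case: z => a b; exact: sqrtr_ge0. Qed.

Lemma Re_le_normc (R : rcfType) (z : R[i]) : complex.Re z <= Normc.normc z.
Proof.
case: z => a b /=; rewrite (le_trans (ler_norm a))// -sqrtr_sqr.
by rewrite ler_wsqrtr// lerDl sqr_ge0.
Qed.

Lemma normc_conjc (R : rcfType) (z : R[i]) :
  Normc.normc z^*%C = Normc.normc z.
Proof. by case: z => a b /=; rewrite sqrrN. Qed.

Lemma Re_mul_conjc (R : rcfType) (z : R[i]) :
  complex.Re (z * z^*%C) = Normc.normc z ^+ 2.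
Proof.
case: z => a b /=; rewrite sqr_sqrtr ?addr_ge0 ?sqr_ge0//.
by rewrite mulrN opprK !expr2.
Qed.

Lemma invn_complex (R : rcfType) (n : nat) : n%:R^-1 = (n%:R^-1 : R)%:C.
Proof. by rewrite fmorphV rmorph_nat. Qed.

Lemma normc_real (R : rcfType) (x : R) : 0 <= x -> Normc.normc x%:C = x.
Proof. by move=> x0 /=; rewrite expr0n addr0 sqrtr_sqr ger0_norm. Qed.

Lemma Re_mulr_real (R : rcfType) (z : R[i]) (x : R) :
  complex.Re (z * x%:C) = complex.Re z * x.
Proof. by case: z => a b /=; rewrite mulr0 subr0. Qed.

Lemma normc_divn (R : rcfType) (z : R[i]) (n : nat) :
  Normc.normc (z / n%:R) = Normc.normc z / n%:R.
Proof. by rewrite Normc.normcM invn_complex normc_real// invr_ge0. Qed.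

(** * Sums over multiples, harmonic sums and the cost of a dilation *)

Lemma big_initial (V : nmodType) (N : nat) (F : nat -> V) :
  \sum_(n <- initial N) F n = \sum_(1 <= n < N.+1) F n.
Proof.
apply: perm_big; apply: uniq_perm; [exact: fset_uniq|exact: iota_uniq|].
by move=> n; rewrite /initial !inE/= /index_iota subn1.
Qed.

Lemma big_nat_dvdn (V : nmodType) (k N : nat) (F : nat -> V) : (0 < k)%N ->
  \sum_(1 <= m < N.+1 | (k %| m)%N) F m
    = \sum_(1 <= n < (N %/ k).+1) F (k * n)%N.
Proof.
move=> k0; rewrite -big_filter -(big_map (muln k) xpredT F).
apply: perm_big; apply: uniq_perm.
- exact/filter_uniq/iota_uniq.
- rewrite map_inj_uniq ?iota_uniq// => a b /eqP.
  by rewrite eqn_pmul2l// => /eqP.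
move=> m; rewrite mem_filter mem_index_iota.
apply/idP/mapP => [/and3P[/dvdnP[n ->]] n0 nN|[n]].
  exists n; last by rewrite mulnC.
  by rewrite mem_index_iota !ltnS leq_divRL//; nia.
rewrite mem_index_iota !ltnS leq_divRL// => /andP[n0 nN] ->.
by rewrite dvdn_mulr//=; nia.
Qed.

(** This is [ln (1 + x) <= x] at x = -1/(n+1), where 1 + x = n/(n+1). *)
Lemma harmonic_step_ln (R : realType) (n : nat) : (0 < n)%N ->
  n.+1%:R^-1 <= ln n.+1%:R - ln n%:R :> R.
Proof.
move=> n0; have n0' : 0 < n%:R :> R by rewrite ltr0n.
have := @le_ln1Dx R (- n.+1%:R^-1).
have -> : 1 + - n.+1%:R^-1 = n%:R / n.+1%:R :> R.
  by rewrite -natr1; field; rewrite natr1 pnatr_eq0.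
rewrite ln_div ?posrE ?ltr0n//.
have : n.+1%:R^-1 < 1 :> R by rewrite invf_lt1 ?ltr1n ?ltr0n.
by rewrite -ltrN2 => h /(_ h); rewrite -lerN2 opprK opprB.
Qed.

Lemma ln_step_harmonic (R : realType) (n : nat) : (0 < n)%N ->
  ln n.+1%:R - ln n%:R <= n%:R^-1 :> R.
Proof.
move=> n0; have n0' : 0 < n%:R :> R by rewrite ltr0n.
rewrite -ln_div ?posrE ?ltr0n//.
have -> : n.+1%:R / n%:R = 1 + n%:R^-1 :> R.
  by rewrite -natr1; field; rewrite pnatr_eq0 -lt0n.
by apply: le_ln1Dx; rewrite (lt_le_trans (y := 0)) ?invr_ge0// ltrN10.
Qed.

Definition harmonic (R : realType) (N : nat) : R :=
  \sum_(1 <= n < N.+1) n%:R^-1.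

(** Telescoping gives the stronger bound with [ln N.+1%:R]. It serves at the very end, to replace
    the normalisation H by ln N. *)
Lemma ln_le_harmonic (R : realType) (N : nat) : (0 < N)%N ->
  ln N%:R <= harmonic R N.
Proof.
move=> N0; have := @telescope_sumr R 1 N.+1 (fun n => ln n%:R) isT.
rewrite ln1 subr0 => h.
have : ln N.+1%:R <= harmonic R N.
  rewrite -h; apply: ler_sum_nat => n /andP[n0 _].
  exact: ln_step_harmonic.
by apply: le_trans; rewrite ler_ln ?posrE ?ltr0n// ler_nat.
Qed.

Lemma harmonic_tail (R : realType) (k N : nat) : (0 < k)%N ->
  \sum_((N %/ k).+1 <= n < N.+1) n%:R^-1 <= 1 + ln k%:R :> R.
Proof.
move=> k0; have lnk : 0 <= ln k%:R :> R by rewrite ln_ge0// ler1n.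
set M := (N %/ k)%N.
have [MN|NM] := ltnP M N; last by rewrite big_geq ?ltnS// addr_ge0.
(* The first term is bounded by 1 on its own. The others, shifted by one, are compared with
   logarithmic increments starting at M + 1, which is positive even when k > N and M = 0; the
   telescoped bound ln N - ln (M+1) is at most ln k because N < k (M+1). *)
rewrite big_nat_recl//=; apply: lerD.
  by rewrite invf_le1 ?ltr0n// ler1n.
apply: (@le_trans _ _ (ln N%:R - ln M.+1%:R)).
  rewrite -(@telescope_sumr R M.+1 N (fun n => ln n%:R))//.
  apply: ler_sum_nat => n /andP[Mn _]; apply: harmonic_step_ln.
  exact: leq_trans Mn.
rewrite lerBlDr -lnM ?posrE ?ltr0n// -natrM ler_ln ?posrE ?ltr0n ?muln_gt0 ?k0//.
- by rewrite ler_nat mulnC ltnW// ltn_ceil.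
- by lia.
Qed.

(** After m = k n the two sums have the same terms and weights for n <= N/k, so their difference is
    the tail N/k < n <= N, which [harmonic_tail] bounds. The factor 1/k stays in the error, so that
    errors can later be summed over P with weights 1/p. *)
Lemma dilation_error (R : realType) (k N : nat) (F : nat -> R[i]) :
  (0 < k)%N -> (forall n, Normc.normc (F n) <= 1) ->
  Normc.normc ((\sum_(1 <= n < N.+1) F n / n%:R) / k%:R
    - \sum_(1 <= m < N.+1 | (k %| m)%N) F (m %/ k)%N / m%:R)
  <= (1 + ln k%:R) / k%:R.
Proof.
move=> k0 F1; rewrite big_nat_dvdn//.
have -> : \sum_(1 <= n < (N %/ k).+1) F (k * n %/ k)%N / (k * n)%:R
  = (\sum_(1 <= n < (N %/ k).+1) F n / n%:R) / k%:R.
  rewrite mulr_suml; apply: eq_bigr => n _.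
  by rewrite mulKn// natrM invfM mulrA mulrAC.
rewrite -mulrBl normc_divn ler_wpM2r ?invr_ge0//.
rewrite (big_cat_nat (n := (N %/ k).+1))//=; last by rewrite ltnS leq_div.
rewrite addrAC subrr add0r.
apply: le_trans (normc_sum _ _ _ _ _) _.
apply: le_trans (harmonic_tail _ _ _ k0).
by apply: ler_sum => n _; rewrite normc_divn ler_piMl ?invr_ge0.
Qed.

(** * Cauchy-Schwarz, the second moment and the removal of g *)

Lemma weighted_cauchy_schwarz (R : realFieldType) (I : Type) (r : seq I)
    (w a : I -> R) :
  (forall i, 0 <= w i) -> 0 < \sum_(i <- r) w i ->
  (\sum_(i <- r) w i * a i) ^+ 2
    <= (\sum_(i <- r) w i) * \sum_(i <- r) w i * a i ^+ 2.
Proof.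
move=> w0; set W := \sum_(i <- r) w i; set S := \sum_(i <- r) _.
set Q := \sum_(i <- r) w i * _ => W0.
(* This nonnegative sum expands to W (W Q - S^2), and W > 0 can be cancelled. *)
have : 0 <= \sum_(i <- r) w i * (W * a i - S) ^+ 2.
  by apply: sumr_ge0 => i _; rewrite mulr_ge0 ?sqr_ge0.
have -> : \sum_(i <- r) w i * (W * a i - S) ^+ 2
    = W ^+ 2 * Q - (2 * W * S) * S + S ^+ 2 * W.
  have -> : \sum_(i <- r) w i * (W * a i - S) ^+ 2 = \sum_(i <- r)
      (W ^+ 2 * (w i * a i ^+ 2) - 2 * W * S * (w i * a i) + S ^+ 2 * w i).
    by apply: eq_bigr => i _; ring.
  by rewrite big_split/= sumrB -!mulr_sumr.
have -> : W ^+ 2 * Q - (2 * W * S) * S + S ^+ 2 * W = W * (W * Q - S ^+ 2).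
  by ring.
by rewrite pmulr_rge0// subr_ge0.
Qed.

(** For distinct primes the substitution m = p q n applies, at the cost given by [dilation_error]
    with k = p q. For p = q the condition is only p | m, and m = p n yields the trivial bound
    [harmonic R N / p%:R]; the hypothesis [p = q -> a = b] gives the correlation a sign in that
    case. *)
Lemma correlation_pair (R : realType) (p q N : nat) (a b : nat -> R[i]) :
  prime p -> prime q ->
  (forall n, Normc.normc (a n) <= 1) -> (forall n, Normc.normc (b n) <= 1) ->
  (p = q -> a = b) ->
  complex.Re (\sum_(1 <= m < N.+1 | (p %| m)%N && (q %| m)%N)
      a (m %/ p)%N * (b (m %/ q)%N)^*%C / m%:R)
  <= complex.Re ((\sum_(1 <= n < N.+1)
        a (q * n)%N * (b (p * n)%N)^*%C / n%:R) / (p * q)%:R)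
     + (1 + ln (p * q)%:R) / (p * q)%:R
     + (if p == q then harmonic R N / p%:R else 0).
Proof.
move=> pp pq a1 b1 ab.
have [p0 q0] := (prime_gt0 pp, prime_gt0 pq).
have pq0 : (0 < p * q)%N by rewrite muln_gt0 p0.
have e0 : 0 <= (1 + ln (p * q)%:R) / (p * q)%:R :> R.
  by rewrite divr_ge0// addr_ge0// ln_ge0// ler1n.
have [epq|npq] := eqVneq p q.
  subst q; have {ab} eab := ab erefl; subst b.
  (* On the diagonal the correlation is a sum of squares, hence can be dropped from the upper bound. *)
  apply: ler_wpDl.
    rewrite addr_ge0// invn_complex Re_mulr_real mulr_ge0 ?invr_ge0//.
    rewrite Re_sum sumr_ge0// => n _.
    by rewrite invn_complex Re_mulr_real Re_mul_conjc mulr_ge0 ?invr_ge0 ?sqr_ge0.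
  apply: le_trans (Re_le_normc _ _) _.
  apply: le_trans (normc_sum _ _ _ _ _) _.
  under eq_bigl do rewrite andbb.
  rewrite big_nat_dvdn//.
  apply: (@le_trans _ _ (\sum_(1 <= n < (N %/ p).+1) n%:R^-1 / p%:R)).
    apply: ler_sum => n _; rewrite normc_divn natrM invfM.
    rewrite [leRHS]mulrC ler_piMl ?mulr_ge0 ?invr_ge0//.
    by rewrite Normc.normcM normc_conjc mulr_ile1 ?normc_ge0.
  rewrite -mulr_suml ler_wpM2r ?invr_ge0//.
  rewrite /harmonic [leRHS](big_cat_nat (n := (N %/ p).+1))//=; last first.
    by rewrite ltnS leq_div.
  by rewrite lerDl sumr_ge0// => n _; rewrite invr_ge0.
(* Coprimality merges the two divisibility conditions into p q | m; writing m = p q n then gives m/p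
   = q n and m/q = p n, which is the origin of the crossed dilations. *)
have copq : coprime p q by rewrite prime_coprime// dvdn_prime2.
pose F n := a (q * n)%N * (b (p * n)%N)^*%C.
have F1 n : Normc.normc (F n) <= 1.
  by rewrite Normc.normcM normc_conjc mulr_ile1 ?normc_ge0.
have -> : \sum_(1 <= m < N.+1 | (p %| m)%N && (q %| m)%N)
      a (m %/ p)%N * (b (m %/ q)%N)^*%C / m%:R
    = \sum_(1 <= m < N.+1 | (p * q %| m)%N) F (m %/ (p * q))%N / m%:R.
  rewrite (eq_bigl (fun m => (p * q %| m)%N)); last first.
    by move=> m; rewrite Gauss_dvd.
  apply: eq_bigr => _ /dvdnP[n ->]; rewrite /F mulnK//.
  have -> : (n * (p * q) %/ p = q * n)%N by rewrite mulnCA mulKn// mulnC.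
  by have -> : (n * (p * q) %/ q = p * n)%N by rewrite mulnA mulnK// mulnC.
rewrite addr0 -lerBlDl.
set D := \sum_(1 <= m < N.+1 | _) _; set E := _ / _.
have -> : complex.Re D - complex.Re E = complex.Re (D - E).
  by case: D => x x'; case: E.
apply: le_trans (Re_le_normc _ _) _.
rewrite -normcN opprB; exact: dilation_error.
Qed.

Lemma second_moment_le (R : realType) (N : nat) (P : {fset nat}) (T : R)
    (a : nat -> nat -> R[i]) :
  (forall p, p \in P -> prime p) ->
  (forall p, p \in P -> forall n, Normc.normc (a p n) <= 1) ->
  (forall p q, p \in P -> q \in P -> 1 + ln (p * q)%:R <= T) ->
  \sum_(1 <= m < N.+1)
     m%:R^-1 * Normc.normc (\sum_(p <- P | (p %| m)%N) a p (m %/ p)%N) ^+ 2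
  <= complex.Re (\sum_(p <- P) \sum_(q <- P) (\sum_(1 <= n < N.+1)
        a p (q * n)%N * (a q (p * n)%N)^*%C / n%:R) / (p * q)%:R)
     + T * (\sum_(p <- P) p%:R^-1) ^+ 2
     + harmonic R N * \sum_(p <- P) p%:R^-1.
Proof.
move=> pP a1 hT.
have -> : \sum_(1 <= m < N.+1)
     m%:R^-1 * Normc.normc (\sum_(p <- P | (p %| m)%N) a p (m %/ p)%N) ^+ 2
  = \sum_(p <- P) \sum_(q <- P)
     complex.Re (\sum_(1 <= m < N.+1 | (p %| m)%N && (q %| m)%N)
      a p (m %/ p)%N * (a q (m %/ q)%N)^*%C / m%:R).
  under [RHS]eq_bigr do rewrite -Re_sum.
  rewrite -Re_sum.
  under eq_bigr do rewrite -Re_mul_conjc mulrC -Re_mulr_real.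
  rewrite -Re_sum; congr complex.Re.
  under [RHS]eq_bigr do under eq_bigr do rewrite big_mkcond/=.
  under [RHS]eq_bigr do rewrite exchange_big/=.
  rewrite exchange_big/=; apply: eq_bigr => m _.
  rewrite -invn_complex mulr_suml mulr_suml big_mkcond; apply: eq_bigr => p _.
  case: ifP => pm /=; last by rewrite big1.
  rewrite rmorph_sum mulr_sumr mulr_suml big_mkcond; apply: eq_bigr => q _.
  by case: ifP.
pose S := \sum_(p <- P) (p%:R^-1 : R).
apply: (@le_trans _ _ (\sum_(p <- P) \sum_(q <- P)
   (complex.Re ((\sum_(1 <= n < N.+1)
        a p (q * n)%N * (a q (p * n)%N)^*%C / n%:R) / (p * q)%:R)
   + T / (p * q)%:R + (if p == q then harmonic R N / p%:R else 0)))).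
  rewrite [leLHS]big_seq [leRHS]big_seq; apply: ler_sum => p Pp.
  rewrite [leLHS]big_seq [leRHS]big_seq; apply: ler_sum => q Pq.
  apply: le_trans (correlation_pair _ _ _ _ _ _ (pP _ Pp) (pP _ Pq) (a1 _ Pp)
    (a1 _ Pq) _) _; first by move=> ->.
  by rewrite lerD2r lerD2l ler_wpM2r ?invr_ge0// hT.
under eq_bigr do rewrite !big_split/=.
rewrite !big_split/= Re_sum; apply: lerD; first apply: lerD.
- by under [leRHS]eq_bigr do rewrite Re_sum.
- rewrite expr2 mulr_suml mulr_sumr; apply: ler_sum => p _.
  rewrite !mulr_sumr; apply: ler_sum => q _.
  by rewrite natrM invfM.
rewrite mulr_sumr [leLHS]big_seq [leRHS]big_seq; apply: ler_sum => p Pp.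
rewrite -big_mkcond/= (eq_bigl (pred1 p)); last by move=> q; rewrite eq_sym.
by rewrite -big_filter filter_pred1_uniq ?fset_uniq// big_seq1.
Qed.

(** The argument p n of [b] becomes m, independent of p, so after exchanging the sums [b m] factors
    out of the sum over p and its modulus is bounded by 1. Each p costs one [dilation_error]. *)
Lemma dilated_sum_dual (R : realType) (N : nat) (P : {fset nat}) (T : R)
    (a : nat -> nat -> R[i]) (b : nat -> R[i]) :
  (forall p, p \in P -> prime p) ->
  (forall p, p \in P -> forall n, Normc.normc (a p n) <= 1) ->
  (forall n, Normc.normc (b n) <= 1) ->
  (forall p, p \in P -> 1 + ln p%:R <= T) ->
  Normc.normc (\sum_(p <- P) (\sum_(1 <= n < N.+1)
      a p n * b (p * n)%N / n%:R) / p%:R)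
  <= \sum_(1 <= m < N.+1)
        m%:R^-1 * Normc.normc (\sum_(p <- P | (p %| m)%N) a p (m %/ p)%N)
     + T * \sum_(p <- P) p%:R^-1.
Proof.
move=> pP a1 b1 hT; set X := \sum_(p <- P) _ / _.
pose Y := \sum_(p <- P) \sum_(1 <= m < N.+1 | (p %| m)%N)
  a p (m %/ p)%N * b m / m%:R.
have -> : X = Y + (X - Y) by rewrite addrC subrK.
apply: le_trans (le_normcD _ _) _; apply: lerD.
  have -> : Y = \sum_(1 <= m < N.+1)
      (\sum_(p <- P | (p %| m)%N) a p (m %/ p)%N) * b m / m%:R.
    rewrite /Y; under eq_bigr do rewrite big_mkcond/=.
    rewrite exchange_big/=; apply: eq_bigr => m _.
    by rewrite mulr_suml mulr_suml [RHS]big_mkcond.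
  apply: le_trans (normc_sum _ _ _ _ _) _; apply: ler_sum => m _.
  rewrite normc_divn mulrC ler_wpM2l ?invr_ge0// Normc.normcM.
  by rewrite ler_piMr ?normc_ge0.
rewrite /X /Y -sumrB; apply: le_trans (normc_sum _ _ _ _ _) _.
rewrite mulr_sumr [leLHS]big_seq [leRHS]big_seq; apply: ler_sum => p Pp.
have p0 := prime_gt0 (pP _ Pp).
apply: (@le_trans _ _ ((1 + ln p%:R) / p%:R)); last first.
  by rewrite ler_wpM2r ?invr_ge0// hT.
pose F n := a p n * b (p * n)%N.
have -> : \sum_(1 <= m < N.+1 | (p %| m)%N) a p (m %/ p)%N * b m / m%:R
    = \sum_(1 <= m < N.+1 | (p %| m)%N) F (m %/ p)%N / m%:R.
  by apply: eq_bigr => m pm; rewrite /F [(p * _)%N]mulnC divnK.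
apply: dilation_error => // n.
by rewrite /F Normc.normcM mulr_ile1 ?normc_ge0 ?a1.
Qed.

(** * Normalisation of the logarithmic averages and final assembly *)

Lemma sum_invn_complex (R : rcfType) (r : seq nat) :
  \sum_(n <- r) n%:R^-1 = (\sum_(n <- r) (n%:R^-1 : R))%:C.
Proof. by rewrite rmorph_sum; apply: eq_bigr => n _; rewrite invn_complex. Qed.

(** The normalising factor is displayed as an embedded real number, so that it passes through the
    modulus and the real part. *)
Lemma log_avgE (R : rcfType) (B : {fset nat}) (F : nat -> R[i]) :
  log_avg B F
    = (\sum_(n <- B) F n / n%:R) * (\sum_(n <- B) (n%:R^-1 : R))^-1%:C.
Proof. by rewrite /log_avg sum_invn_complex fmorphV. Qed.

Lemma log_avg_initial (R : realType) (N : nat) (F : nat -> R[i]) :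
  log_avg (initial N) F
    = (\sum_(1 <= n < N.+1) F n / n%:R) * (harmonic R N)^-1%:C.
Proof. by rewrite log_avgE !big_initial. Qed.

Lemma half_le_ln2 (R : realType) : 2^-1 <= ln 2 :> R.
Proof. by have := @harmonic_step_ln R 1 isT; rewrite ln1 subr0. Qed.

(* Here A = sum of 1/p, H = sum of 1/n, l = ln y, x and t are the unnormalised averages before and after the substitution m = p n, Q is the second moment over m, and E is the unnormalised correlation. *)
Lemma combine_errors (R : realFieldType) (A H x t Q E l : R) :
  0 < A -> 0 < H -> 0 <= l -> 0 <= x -> 0 <= t -> x <= A * H ->
  x <= t + 3 * l * A -> t ^+ 2 <= H * Q ->
  Q <= E + 4 * l * A ^+ 2 + H * A ->
  (x * H^-1 / A) ^+ 2
    <= E * H^-1 / A / A + 10 * (A^-1 + l / H).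
Proof.
move=> A0 H0 l0 x0 t0 xAH xt tQ QE.
have x2 : x ^+ 2 <= t ^+ 2 + 6 * l * A * (A * H).
  (* The trivial bound on x makes the error in x ^+ 2 linear in l, with no l ^+ 2 term. *)
  have [le_xt|lt_tx] := leP x t.
    apply: ler_wpDr; last by rewrite ler_sqr.
    by rewrite !mulr_ge0// ltW.
  have h1 : (x - t) * (x + t) <= 3 * l * A * (2 * (A * H)).
    by apply: ler_pM; rewrite ?subr_ge0 ?addr_ge0 ?(ltW lt_tx)//; lra.
  by move: h1; rewrite -subr_sqr; lra.
have HQ : H * Q <= H * (E + 4 * l * A ^+ 2 + H * A).
  by rewrite ler_wpM2l// ltW.
have AH0 : 0 < (A * H) ^+ 2 by rewrite exprn_gt0// mulr_gt0.
have -> : (x * H^-1 / A) ^+ 2 = x ^+ 2 / (A * H) ^+ 2.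
  by field; rewrite !gt_eqF.
rewrite ler_pdivrMr//.
(* The coefficient of l A^2 H is 10 = 4 + 6, from the second moment and from the passage from x to
   t. The diagonal needs only one H^2 A, which leaves 9 of them to spare. *)
have -> : (E * H^-1 / A / A + 10 * (A^-1 + l / H)) * (A * H) ^+ 2
   = H * (E + 4 * l * A ^+ 2 + H * A) + 6 * l * A * (A * H)
     + 9 * (H ^+ 2 * A).
  by field; rewrite !gt_eqF.
have : 0 <= H ^+ 2 * A by rewrite mulr_ge0 ?sqr_ge0// ltW.
lra.
Qed.

Theorem theorem5p2 (R : realType) :
  exists C : R, 0 < C /\
    forall (y : R) (P : {fset nat}) (f : nat -> int -> R[i]) (g : int -> R[i]),
      1 <= y ->
      P != fset0 ->
      (forall p : nat, p \in P -> prime p /\ p%:R <= y) ->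
      (forall p : nat, p \in P -> forall m : int, Normc.normc (f p m) <= 1) ->
      (forall m : int, Normc.normc (g m) <= 1) ->
      forall N : nat, (2 <= N)%N ->
        Normc.normc
          (log_avg P (fun p : nat =>
             log_avg (initial N) (fun n : nat =>
               f p n%:Z * g (p%:Z * n%:Z)))) ^+ 2
        <= complex.Re
             (log_avg2 P (fun p q : nat =>
                log_avg (initial N) (fun n : nat =>
                  f p (q%:Z * n%:Z) * (f q (p%:Z * n%:Z))^*%C)))
           + C * ((\sum_(p <- P) (p%:R)^-1)^-1 + ln y / ln (N%:R)).
Proof.
exists 10; split=> // y P f g y1 P0 Py f1 g1 N N2.
have pP p : p \in P -> prime p by case/Py.
have ln_p p : p \in P -> ln p%:R <= ln y.
  case/Py => pp py; rewrite ler_ln ?posrE ?ltr0n ?prime_gt0//.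
  exact: lt_le_trans y1.
have lny0 : 0 <= ln y by rewrite ln_ge0.
(* P contains a prime, so y >= 2. This absorbs the constant 1 of the dilation errors: 1 + ln p <= 3
   ln y and 1 + ln (pq) <= 4 ln y. *)
have lny2 : 1 <= 2 * ln y.
  have /fset0Pn[p Pp] := P0.
  have : ln 2 <= ln p%:R :> R.
    rewrite ler_ln ?posrE ?ltr0n//; last exact/prime_gt0/pP.
    by rewrite ler_nat; exact/prime_gt1/pP.
  have := half_le_ln2 R; have := ln_p _ Pp; lra.
pose A := \sum_(p <- P) (p%:R^-1 : R); pose H := harmonic R N.
have A0 : 0 < A.
  have /fset0Pn[p Pp] := P0.
  rewrite /A (bigD1_seq p) ?fset_uniq//= ltr_wpDr//.
    by apply: sumr_ge0 => q _; rewrite invr_ge0.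
  by rewrite invr_gt0 ltr0n; exact/prime_gt0/pP.
have lnN0 : 0 < ln N%:R :> R by rewrite ln_gt0// ltr1n.
have lnNH : ln N%:R <= H by apply: ln_le_harmonic; exact: ltnW.
have H0 : 0 < H by exact: lt_le_trans lnNH.
pose a (p n : nat) := f p n%:Z; pose b (n : nat) := g n%:Z.
have a1 p : p \in P -> forall n, Normc.normc (a p n) <= 1.
  by move=> Pp n; exact: f1.
have b1 n : Normc.normc (b n) <= 1 by exact: g1.
pose X := \sum_(p <- P) (\sum_(1 <= n < N.+1)
  a p n * b (p * n)%N / n%:R) / p%:R.
pose E := \sum_(p <- P) \sum_(q <- P) (\sum_(1 <= n < N.+1)
  a p (q * n)%N * (a q (p * n)%N)^*%C / n%:R) / (p * q)%:R.
have -> : log_avg P (fun p : nat => log_avg (initial N) (fun n : nat =>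
    f p n%:Z * g (p%:Z * n%:Z))) = X * H^-1%:C * A^-1%:C.
  rewrite log_avgE; congr (_ * _); rewrite /X mulr_suml.
  by apply: eq_bigr => p _; rewrite log_avg_initial mulrAC.
have -> : log_avg2 P (fun p q : nat => log_avg (initial N) (fun n : nat =>
    f p (q%:Z * n%:Z) * (f q (p%:Z * n%:Z))^*%C))
  = E * H^-1%:C * A^-1%:C * A^-1%:C.
  rewrite /log_avg2 log_avgE; congr (_ * _).
  rewrite /E !mulr_suml; apply: eq_bigr => p _.
  rewrite log_avgE mulrAC; congr (_ * _).
  rewrite !mulr_suml; apply: eq_bigr => q _.
  rewrite log_avg_initial natrM invfM; ring.
rewrite !Re_mulr_real !Normc.normcM !normc_real ?invr_ge0 ?(ltW A0) ?(ltW H0)//.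
pose t := \sum_(1 <= m < N.+1)
  m%:R^-1 * Normc.normc (\sum_(p <- P | (p %| m)%N) a p (m %/ p)%N).
pose Q := \sum_(1 <= m < N.+1)
  m%:R^-1 * Normc.normc (\sum_(p <- P | (p %| m)%N) a p (m %/ p)%N) ^+ 2.
(* The trivial bound, which [combine_errors] uses to keep the error linear in ln y. *)
have XAH : Normc.normc X <= A * H.
  apply: le_trans (normc_sum _ _ _ _ _) _.
  rewrite /A mulr_suml [leLHS]big_seq [leRHS]big_seq.
  apply: ler_sum => p Pp; rewrite normc_divn mulrC ler_wpM2l ?invr_ge0//.
  apply: le_trans (normc_sum _ _ _ _ _) _; apply: ler_sum => n _.
  rewrite normc_divn ler_piMl ?invr_ge0// Normc.normcM.
  by rewrite mulr_ile1 ?normc_ge0 ?a1.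
have Xt : Normc.normc X <= t + 3 * ln y * A.
  apply: dilated_sum_dual => // p Pp; have := ln_p _ Pp; lra.
have tQ : t ^+ 2 <= H * Q.
  by apply: weighted_cauchy_schwarz => // n; rewrite invr_ge0.
have QE : Q <= complex.Re E + 4 * ln y * A ^+ 2 + H * A.
  apply: second_moment_le => // p q Pp Pq.
  rewrite natrM lnM ?posrE ?ltr0n; [|exact/prime_gt0/pP..].
  have := ln_p _ Pp; have := ln_p _ Pq; lra.
have t0 : 0 <= t.
  by apply: sumr_ge0 => m _; rewrite mulr_ge0 ?invr_ge0 ?normc_ge0.
apply: le_trans (combine_errors _ _ _ _ _ _ _ _ A0 H0 lny0 (normc_ge0 _ X) t0
  XAH Xt tQ QE) _.
(* Only the error is weakened here, from ln y / H to ln y / ln N; the main terms keep their exact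
   normalisation by H. *)
by rewrite lerD2l ler_wpM2l// lerD2l ler_wpM2l// lef_pV2.
Qed.
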